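(* Consider the setting without covariates and let $\ell:\mathcal D\times\mathcal Y^{\mathcal D}\to\mathbb R$ be a counterfactual loss, with associated vector $\boldsymbol\ell=\{\ell(d;\boldsymbol y)\}_{d\in\mathcal D,\boldsymbol y\in\mathcal Y^{\mathcal D}}\in\mathbb R^{KM^K}$. The counterfactual risk $R_P(\pi;\ell)$ is identifiable for every policy $\pi\in\Delta(\mathcal D)$ if and only if the linear system $$\boldsymbol A^{\mathrm{exa}}\boldsymbol w^{\mathrm{exa}}=\boldsymbol\ell$$ has a solution $\boldsymbol w^{\mathrm{exa}}\in\mathbb R^{K^2M}$.
   Context: Setup (no covariates). $K,M\ge 2$ are integers, $\mathcal D=\{0,\dots,K-1\}$ (decisions), $\mathcal Y=\{0,\dots,M-1\}$ (outcomes), $\Delta(S)$ is the set of probability distributions on $S$. Potential outcomes are $Y(k)\in\mathcal Y$, $k\in\mathcal D$, with $Y(\mathcal D)=(Y(0),\dots,Y(K-1))\in\mathcal Y^{\mathcal D}$; $D\in\mathcal D$ is the observed decision and the observed outcome is $Y=Y(D)$ (consistency). $\mathcal P$ is the set of all joint laws $P$ of $(D,Y(\mathcal D))$ satisfying strong ignorability: $D$ is independent of $Y(\mathcal D)$ (unconfoundedness) and $P(D=d)>0$ for every $d\in\mathcal D$ (overlap); the law of $Y(\mathcal D)$ is otherwise arbitrary. The observed law $Q_P$ is $Q_P(D=k,Y=y)=P(D=k,Y(k)=y)$. A policy is an element $\pi\in\Delta(\mathcal D)$. The counterfactual risk is $R_P(\pi;\ell)=\sum_{d\in\mathcal D}\sum_{\boldsymbol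 y\in\mathcal Y^{\mathcal D}}\ell(d;\boldsymbol y)\,\pi(d)\,P(Y(\mathcal D)=\boldsymbol y)$. A functional $\theta:\mathcal P\to\mathbb R$ is identifiable if $Q_{P_1}=Q_{P_2}$ implies $\theta(P_1)=\theta(P_2)$ for all $P_1,P_2\in\mathcal P$. The linear system. Vectors $\boldsymbol w^{\mathrm{exa}}\in\mathbb R^{K^2M}$ are written as $\boldsymbol w^{\mathrm{exa}}=\{\omega_k(d,y)\}_{d\in\mathcal D,k\in\mathcal D,y\in\mathcal Y}$ (weight values only, no intercept). $\boldsymbol A^{\mathrm{exa}}$ is the fixed $0$–$1$ matrix of size $KM^K\times K^2M$, with rows indexed by $(d,\boldsymbol y)\in\mathcal D\times\mathcal Y^{\mathcal D}$, such that $$(\boldsymbol A^{\mathrm{exa}}\boldsymbol w^{\mathrm{exa}})_{(d,\boldsymbol y)}=\sum_{k\in\mathcal D}\omega_k(d,y_k).$$ *)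

(* Defs.v *)
From HB Require Import structures.
From mathcomp Require Import all_boot all_order all_algebra.
From mathcomp Require Import reals.

Set Implicit Arguments.
Unset Strict Implicit.
Unset Printing Implicit Defensive.

Import Order.TTheory GRing.Theory Num.Theory.
Local Open Scope ring_scope.

Record dist (R : realType) (T : finType) := Dist {
  pmf :> {ffun T -> R};
  dist_ge0 : forall x, 0 <= pmf x;
  dist_sum1 : \sum_x pmf x = 1
}.

Definition Pr (R : realType) (T : finType) (P : dist R T) (E : pred T) : R :=
  \sum_(x | E x) P x.

Definition independent (R : realType) (T A B : finType) (P : dist R T)
    (X : T -> A) (Z : T -> B) : Prop :=
  forall (S : {set A}) (U : {set B}),
    Pr P [pred t | (X t \in S) && (Z t \in U)] =
    Pr P [pred t | X t \in S] * Pr P [pred t | Z t \in U].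

(* Values of the vector Y(D) of potential outcomes: y k is the value of Y(k). *)
Definition outcomes (K M : nat) : finType := {ffun 'I_K -> 'I_M}.

(* Sample space of (D, Y(D)). *)
Definition sample (K M : nat) : finType := ('I_K * outcomes K M)%type.

(* The class of joint laws of (D, Y(D)) satisfying strong ignorability. *)
Record ignorable_law (R : realType) (K M : nat) := IgnorableLaw {
  law :> dist R (sample K M);
  unconfoundedness :
    independent law (fun s : sample K M => s.1) (fun s : sample K M => s.2);
  overlap : forall d : 'I_K, 0 < Pr law [pred s : sample K M | s.1 == d]
}.

(* By consistency Y = Y(D), so {D = k, Y = y} is the event {D = k, Y(k) = y}. *)
Definition observed_law (R : realType) (K M : nat) (P : ignorable_law R K M) :
    {ffun 'I_K * 'I_M -> R} :=
  [ffun ky => Pr P [pred s : sample K M | (s.1 == ky.1) && (s.2 ky.1 == ky.2)]].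

Definition identifiable (R : realType) (K M : nat)
    (theta : ignorable_law R K M -> R) : Prop :=
  forall P1 P2 : ignorable_law R K M,
    observed_law P1 = observed_law P2 -> theta P1 = theta P2.

Definition risk (R : realType) (K M : nat) (P : ignorable_law R K M)
    (pi : dist R 'I_K) (l : 'I_K -> outcomes K M -> R) : R :=
  \sum_(d : 'I_K) \sum_(y : outcomes K M)
    l d y * pi d * Pr P [pred s : sample K M | s.2 == y].

(* Rows are indexed by pairs (d, y); columns by triples (d, k, y), the column
   (d, k, y) carrying the weight omega_k(d, y). Both finite types are
   enumerated by enum_val / enum_rank; the order plays no role. *)
Definition exa_row (K M : nat) : finType := ('I_K * outcomes K M)%type.
Definition exa_col (K M : nat) : finType := ('I_K * 'I_K * 'I_M)%type.

Definition Aexa (R : realType) (K M : nat) :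
    'M[R]_(#|exa_row K M|, #|exa_col K M|) :=
  \matrix_(i, j)
    (let: (d, y) := enum_val i : 'I_K * outcomes K M in
     let: (d', k, z) := enum_val j : 'I_K * 'I_K * 'I_M in
     ((d' == d) && (y k == z))%:R).

Definition loss_vec (R : realType) (K M : nat)
    (l : 'I_K -> outcomes K M -> R) : 'cV[R]_#|exa_row K M| :=
  \col_i l (enum_val i).1 (enum_val i).2.

Lemma card_exa_row (K M : nat) : #|exa_row K M| = (K * M ^ K)%N.
Proof. by rewrite card_prod card_ffun !card_ord. Qed.

Lemma card_exa_col (K M : nat) : #|exa_col K M| = (K ^ 2 * M)%N.
Proof. by rewrite !card_prod !card_ord. Qed.

Lemma Aexa_mulE (R : realType) (K M : nat) (w : 'cV[R]_#|exa_col K M|)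
    (d : 'I_K) (y : outcomes K M) :
  (Aexa R K M *m w) (enum_rank ((d, y) : exa_row K M)) 0 =
  \sum_(k < K) w (enum_rank ((d, k, y k) : exa_col K M)) 0.
Proof.
rewrite mxE.
rewrite (reindex (@enum_rank (exa_col K M))); last first.
  by apply: onW_bij; apply: enum_rank_bij.
under eq_bigr => c _ do rewrite mxE !enum_rankK.
transitivity (\sum_(d' < K) \sum_(k < K) \sum_(z < M)
    ((d' == d) && (y k == z))%:R * w (enum_rank ((d', k, z) : exa_col K M)) 0).
  by rewrite !pair_bigA /=; apply: eq_bigr => -[[d' k] z].
rewrite (bigD1 d) //= [X in _ + X]big1 ?addr0; last first.
  move=> d' /negPf nd; apply: big1 => k _; apply: big1 => z _.
  by rewrite nd mul0r.
apply: eq_bigr => k _; rewrite (bigD1 (y k)) //= !eqxx mul1r big1 ?addr0 //.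
by move=> z /negPf nz; rewrite eq_sym nz andbF mul0r.
Qed.

(* Main.v *)
Require Import Defs.
From HB Require Import structures.
From mathcomp Require Import all_boot all_order all_algebra.
From mathcomp Require Import reals.

Set Implicit Arguments.
Unset Strict Implicit.
Unset Printing Implicit Defensive.

Import Order.TTheory GRing.Theory Num.Theory.
Local Open Scope ring_scope.

(** The system is solvable exactly when each l(d; .) is additive, that is
    l(d; y) = sum_k omega_k(d, y_k).

    An additive loss has a risk that depends on P only through the marginals
    of the Y(k). Ignorability makes these functions of the observed law Q:
    P(Y(k) = z) = Q(k, z) / sum_z' Q(k, z') ([observed_law_marginal]).

    Conversely, the policy may be taken deterministic, so that E l(d; Y(D)) is
    determined by Q for each d. Two well chosen laws of Y(D) then force l(d; .)
    to be additive, without any duality or dimension count. Fix a reference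
    outcome z0, write o for the constant vector z0 and y^(k) for o with its
    k-th coordinate replaced by y_k. Drawing uniformly from the K-point list
    (y, o, ..., o) or from the list (y^(0), ..., y^(K-1)) gives the same
    marginals: in either list the k-th coordinate is once y_k and K - 1 times
    z0. With D uniform and independent of Y(D) the two laws are therefore
    observationally equal, and equality of the risks reads
      l(d; y) + (K - 1) l(d; o) = sum_k l(d; y^(k))     ([loss_interpolation]).
    Since y^(k) depends on y only through y_k, spreading (K - 1) l(d; o) evenly
    over the K summands gives the weights omega_k. *)

(** * Expectations and empirical laws *)

Definition Ex (R : realType) (T : finType) (P : dist R T) (h : T -> R) : R :=
  \sum_t P t * h t.

Lemma Pr_Ex (R : realType) (T : finType) (P : dist R T) (E : pred T) :
  Pr P E = Ex P (fun t => (E t)%:R).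
Proof.
rewrite /Pr /Ex big_mkcond; apply: eq_bigr => t _.
by case: (E t); rewrite ?mulr1 ?mulr0.
Qed.

Lemma sum_mul_Pr_fiber (R : realType) (T A : finType) (P : dist R T)
    (X : T -> A) (h : A -> R) :
  \sum_a h a * Pr P [pred t | X t == a] = Ex P (fun t => h (X t)).
Proof.
rewrite /Ex (partition_big X xpredT) //=; apply: eq_bigr => a _.
by rewrite mulr_sumr; apply: eq_bigr => t /eqP <-; rewrite mulrC.
Qed.

Section Empirical.
Variables (R : realType) (I T : finType) (f : I -> T).

Definition empirical_pmf : {ffun T -> R} :=
  [ffun t => #|I|%:R^-1 * \sum_i (f i == t)%:R].

Lemma empirical_ge0 t : 0 <= empirical_pmf t.
Proof.
by rewrite ffunE mulr_ge0 ?invr_ge0 ?ler0n // sumr_ge0 // => i _; rewrite ler0n.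
Qed.

Lemma sum_empirical_pmf (h : T -> R) :
  \sum_t empirical_pmf t * h t = #|I|%:R^-1 * \sum_i h (f i).
Proof.
under eq_bigr => t _ do rewrite ffunE -mulrA mulr_suml.
rewrite -mulr_sumr exchange_big /=; congr (_ * _); apply: eq_bigr => i _.
rewrite (bigD1 (f i)) //= eqxx mul1r big1 ?addr0 // => t.
by rewrite eq_sym => /negPf ->; rewrite mul0r.
Qed.

Hypothesis I_gt0 : (0 < #|I|)%N.

Lemma empirical_sum1 : \sum_t empirical_pmf t = 1.
Proof.
under eq_bigr => t _ do rewrite -[empirical_pmf t]mulr1.
by rewrite sum_empirical_pmf sumr_const mulVf // pnatr_eq0 -lt0n.
Qed.

Definition empirical : dist R T := Dist empirical_ge0 empirical_sum1.

Lemma Ex_empirical (h : T -> R) :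
  Ex empirical h = #|I|%:R^-1 * \sum_i h (f i).
Proof. exact: sum_empirical_pmf. Qed.

End Empirical.

(** * Identification of the risk of an additive loss *)

Lemma risk_Ex (R : realType) (K M : nat) (P : ignorable_law R K M)
    (pi : dist R 'I_K) (l : 'I_K -> outcomes K M -> R) :
  risk P pi l = \sum_d pi d * Ex P (fun s => l d s.2).
Proof.
apply: eq_bigr => d _; rewrite -(sum_mul_Pr_fiber P snd (l d)) mulr_sumr.
by apply: eq_bigr => y _; rewrite mulrA [l d y * _]mulrC.
Qed.

Lemma sum_observed_law (R : realType) (K M : nat) (P : ignorable_law R K M)
    (k : 'I_K) :
  \sum_z observed_law P (k, z) = Pr P [pred s : sample K M | s.1 == k].
Proof.
rewrite /Pr [RHS](partition_big (fun s : sample K M => s.2 k) xpredT) //=.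
by apply: eq_bigr => z _; rewrite ffunE.
Qed.

(** Dividing by P(D = k) is where overlap is needed. *)
Lemma observed_law_marginal (R : realType) (K M : nat)
    (P : ignorable_law R K M) (k : 'I_K) (z : 'I_M) :
  Pr P [pred s : sample K M | s.2 k == z] =
  observed_law P (k, z) / \sum_z' observed_law P (k, z').
Proof.
rewrite sum_observed_law ffunE /=.
suff -> : Pr P [pred s : sample K M | (s.1 == k) && (s.2 k == z)] =
    Pr P [pred s : sample K M | s.1 == k] *
    Pr P [pred s : sample K M | s.2 k == z].
  by rewrite mulrAC divff ?mul1r // gt_eqF // overlap.
have := unconfoundedness P [set k] [set y : outcomes K M | y k == z].
by congr (_ = _ * _); apply: eq_bigl => s; rewrite /= !inE.
Qed.

Lemma additive_loss_identifiable (R : realType) (K M : nat)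
    (l : 'I_K -> outcomes K M -> R) (w : 'I_K -> 'I_K -> 'I_M -> R)
    (lE : forall d y, l d y = \sum_k w d k (y k)) (pi : dist R 'I_K) :
  identifiable (fun P : ignorable_law R K M => risk P pi l).
Proof.
move=> P1 P2 eqQ; rewrite !risk_Ex; apply: eq_bigr => d _; congr (_ * _).
have ExE (P : ignorable_law R K M) : Ex P (fun s => l d s.2) =
    \sum_k \sum_z w d k z * Pr P [pred s : sample K M | s.2 k == z].
  under [RHS]eq_bigr => k _ do
    rewrite (sum_mul_Pr_fiber P (fun s : sample K M => s.2 k)).
  rewrite /Ex exchange_big /=; apply: eq_bigr => s _.
  by rewrite lE mulr_sumr.
rewrite !ExE; apply: eq_bigr => k _; apply: eq_bigr => z _.
by rewrite !observed_law_marginal eqQ.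
Qed.

(** * Additivity of a loss with identifiable risk *)

Section PointList.
Variables (R : realType) (K M : nat) (K_gt0 : (0 < K)%N).
Implicit Type f : 'I_K -> outcomes K M.

Lemma card_ord2_gt0 : (0 < #|{: 'I_K * 'I_K}|)%N.
Proof. by rewrite card_prod card_ord muln_gt0 K_gt0. Qed.

(** The law with D uniform and Y(D) drawn independently and uniformly from the
    list f: the product law is itself the empirical law of the K^2 pairs. *)
Definition list_dist f : dist R (sample K M) :=
  empirical R (fun ij : 'I_K * 'I_K => (ij.1, f ij.2) : sample K M)
    card_ord2_gt0.

Lemma Ex_list_dist_mul f (g : 'I_K -> R) (h : outcomes K M -> R) :
  Ex (list_dist f) (fun s => g s.1 * h s.2) =
  (K%:R^-1 * \sum_i g i) * (K%:R^-1 * \sum_j h (f j)).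
Proof.
rewrite Ex_empirical card_prod card_ord natrM invfM mulrACA; congr (_ * _).
rewrite -(pair_bigA _ (fun i j => g i * h (f j))) /= mulr_suml.
by apply: eq_bigr => i _; rewrite mulr_sumr.
Qed.

Lemma mean_const1 : K%:R^-1 * \sum_(i < K) 1 = 1 :> R.
Proof. by rewrite sumr_const card_ord mulVf // pnatr_eq0 -lt0n. Qed.

Lemma Pr_list_dist_and f (E : pred 'I_K) (F : pred (outcomes K M)) :
  Pr (list_dist f) [pred s | E s.1 && F s.2] =
  (K%:R^-1 * \sum_i (E i)%:R) * (K%:R^-1 * \sum_j (F (f j))%:R).
Proof.
rewrite Pr_Ex -(Ex_list_dist_mul f (fun i => (E i)%:R) (fun y => (F y)%:R)).
by apply: eq_bigr => s _; rewrite /= -natrM mulnb.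
Qed.

Lemma Pr_list_dist_fst f (E : pred 'I_K) :
  Pr (list_dist f) [pred s | E s.1] = K%:R^-1 * \sum_i (E i)%:R.
Proof.
have := Pr_list_dist_and f E xpredT; rewrite mean_const1 mulr1 => <-.
by apply: eq_bigl => s; rewrite /= andbT.
Qed.

Lemma Pr_list_dist_snd f (F : pred (outcomes K M)) :
  Pr (list_dist f) [pred s | F s.2] = K%:R^-1 * \sum_j (F (f j))%:R.
Proof. by have := Pr_list_dist_and f xpredT F; rewrite mean_const1 mul1r. Qed.

Lemma Ex_list_dist_snd f (h : outcomes K M -> R) :
  Ex (list_dist f) (fun s => h s.2) = K%:R^-1 * \sum_j h (f j).
Proof.
have := Ex_list_dist_mul f (fun=> 1) h; rewrite mean_const1 mul1r => <-.
by apply: eq_bigr => s _; rewrite mul1r.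
Qed.

Lemma list_dist_independent f :
  independent (list_dist f) (fun s : sample K M => s.1) (fun s => s.2).
Proof.
move=> S U; rewrite (Pr_list_dist_and f (mem S) (mem U)).
by rewrite (Pr_list_dist_fst f (mem S)) (Pr_list_dist_snd f (mem U)).
Qed.

Lemma list_dist_overlap f (d : 'I_K) :
  0 < Pr (list_dist f) [pred s : sample K M | s.1 == d].
Proof.
rewrite (Pr_list_dist_fst f (pred1 d)) mulr_gt0 ?invr_gt0 ?ltr0n //.
by rewrite (bigD1 d) //= eqxx ltr_pwDl ?ltr01 // sumr_ge0 // => i _; rewrite ler0n.
Qed.

Definition list_law f : ignorable_law R K M :=
  IgnorableLaw (list_dist_independent f) (list_dist_overlap f).

Lemma list_law_observed f1 f2 :
  (forall k z, \sum_j (f1 j k == z)%:R = \sum_j (f2 j k == z)%:R :> R) ->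
  observed_law (list_law f1) = observed_law (list_law f2).
Proof.
move=> eqf; apply/ffunP => -[k z]; rewrite !ffunE /=.
by rewrite !(Pr_list_dist_and _ (pred1 k) (fun y => y k == z)) /= eqf.
Qed.

Lemma sum_if_eq (A : Type) (i0 : 'I_K) (F : A -> R) (a b : A) :
  \sum_j F (if j == i0 then a else b) = F a + K.-1%:R * F b.
Proof.
rewrite (bigD1 i0) //= eqxx; congr (_ + _).
under eq_bigr => j /negPf -> do [].
by rewrite sumr_const cardC1 card_ord mulr_natl.
Qed.

(** With z := y k this is the vector written y^(k) in the introduction. *)
Definition spike (z0 : 'I_M) (k : 'I_K) (z : 'I_M) : outcomes K M :=
  [ffun j => if j == k then z else z0].

Variable l : 'I_K -> outcomes K M -> R.
Hypothesis l_id : forall pi : dist R 'I_K,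
  identifiable (fun P : ignorable_law R K M => risk P pi l).

(** Equal marginals of the two lists make the laws observationally equal, and
    a deterministic policy isolates the loss of a single decision. *)
Lemma identifiable_list_sum (d : 'I_K) f1 f2 :
  (forall k z, \sum_j (f1 j k == z)%:R = \sum_j (f2 j k == z)%:R :> R) ->
  \sum_j l d (f1 j) = \sum_j l d (f2 j).
Proof.
move=> /list_law_observed eqQ.
have unit_gt0 : (0 < #|{: unit}|)%N by rewrite card_unit.
(* The point mass at d, as the empirical law of a one-element list. *)
pose delta := empirical R (fun=> d) unit_gt0.
have riskE f : risk (list_law f) delta l = K%:R^-1 * \sum_j l d (f j).
  rewrite risk_Ex -[LHS]/(Ex delta _) Ex_empirical card_unit invr1 mul1r.
  by rewrite big_const card_unit /= addr0 (Ex_list_dist_snd f (l d)).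
have := l_id delta eqQ; rewrite /= !riskE.
by apply: mulfI; rewrite invr_eq0 pnatr_eq0 -lt0n.
Qed.

(** Compares the lists (y, o, ..., o) and (y^(0), ..., y^(K-1)): the k-th
    coordinate equals y k only at the first entry of the former and only at
    entry k of the latter (up to the coincidence y k = z0), so both lists have
    the same marginals. *)
Lemma loss_interpolation (z0 : 'I_M) (d : 'I_K) (y : outcomes K M) :
  l d y + K.-1%:R * l d [ffun=> z0] = \sum_k l d (spike z0 k (y k)).
Proof.
pose i0 := Ordinal K_gt0.
(* Reads the left-hand side as the sum of l d over (y, o, ..., o). *)
rewrite -(sum_if_eq i0 (l d)); apply: identifiable_list_sum => k z.
transitivity (\sum_j ((if j == i0 then y k else z0) == z)%:R : R).
  by apply: eq_bigr => j _; case: (j == i0); rewrite ?ffunE.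
rewrite (sum_if_eq i0 (fun u => (u == z)%:R)).
rewrite -(sum_if_eq k (fun u => (u == z)%:R)).
by apply: eq_bigr => j _; rewrite ffunE [k == j]eq_sym; case: (j =P k) => // ->.
Qed.

Lemma identifiable_loss_additive (z0 : 'I_M) (d : 'I_K) (y : outcomes K M) :
  l d y = \sum_k (l d (spike z0 k (y k)) -
                  K%:R^-1 * (K.-1%:R * l d [ffun=> z0])).
Proof.
rewrite sumrB -loss_interpolation sumr_const card_ord -[X in _ - X]mulr_natl.
by rewrite mulVKf ?addrK // pnatr_eq0 -lt0n.
Qed.

End PointList.

Theorem corollary6 (R : realType) (K M : nat) (hK : (2 <= K)%N) (hM : (2 <= M)%N)
    (l : 'I_K -> outcomes K M -> R) :
  (forall pi : dist R 'I_K, identifiable (fun P : ignorable_law R K M => risk P pi l))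
  <->
  (exists w : 'cV[R]_#|exa_col K M|, Aexa R K M *m w = loss_vec l).
Proof.
split=> [l_id | [w Aw] pi]; last first.
  apply: (@additive_loss_identifiable _ _ _ _
    (fun d k z => w (enum_rank ((d, k, z) : exa_col K M)) 0)) => d y.
  by rewrite -Aexa_mulE Aw mxE enum_rankK.
have K_gt0 : (0 < K)%N := ltnW hK.
pose z0 : 'I_M := Ordinal (ltnW hM).
exists (\col_c let: (d, k, z) := enum_val c : 'I_K * 'I_K * 'I_M in
  l d (spike z0 k z) - K%:R^-1 * (K.-1%:R * l d [ffun=> z0])).
apply/matrixP => i j; rewrite (ord1 j) [RHS]mxE -{1}(enum_valK i).
case: (enum_val i) => d y; rewrite Aexa_mulE /=.
rewrite [RHS](identifiable_loss_additive K_gt0 l_id z0).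
by apply: eq_bigr => k _; rewrite mxE enum_rankK.
Qed.
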